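(* Let $(p,q)$ be a pair of non-zero integers such that $pq<0$. Then there is a generalized torsion element in $\pi_{1}(K_{p,q}(0))$.
   Context: Notation: $[g,h]=g^{-1}h^{-1}gh$ and $g^{h}=h^{-1}gh$. A generalized torsion element of a group $F$ is a non-trivial element $g\in F$ for which there exist a positive integer $n$ and $h_1,\dots,h_n\in F$ with $g^{h_1}g^{h_2}\cdots g^{h_n}=1$. For non-zero integers $p,q$, $K_{p,q}\subset S^3$ denotes the double twist knot of type $(p,q)$: the two-bridge knot with Conway notation $C[2p,2q]$ (continued fraction $2p+\frac{1}{2q}$), with conventions such that $K_{1,1}$ is the figure eight knot and $K_{1,-1}$ is the right-handed trefoil. $K_{p,q}(0)$ denotes the closed 3-manifold obtained from $S^3$ by $0$-surgery along $K_{p,q}$. Its fundamental group has the presentation $$\pi_1(K_{p,q}(0))=\langle a,b,t \mid ta^{p}t^{-1}=b^{-1}a^{p},\ tb^{-q}a^{-1}t^{-1}=b^{-q},\ [b^{q},a^{p}]=1\rangle,$$ where $t$ is a meridian of $K_{p,q}$ and $[b^q,a^p]$ is the canonical longitude. *)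

(* Defs.v *)
From HB Require Import structures.
From mathcomp Require Import all_boot all_order all_algebra.
From mathcomp Require Import generic_quotient boolp.

Set Implicit Arguments.
Unset Strict Implicit.
Unset Printing Implicit Defensive.

Local Open Scope group_scope.
Local Open Scope quotient_scope.

Definition zexpg (G : baseGroupType) (x : G) (z : int) : G :=
  match z with
  | Posz n => x ^+ n
  | Negz n => x ^- n.+1
  end.

(* The library's x ^ y is conjugation, y^-1 * (x * y), and its [~ x, y] is
   x^-1 * (y^-1 * (x * y)). *)
Notation "x ^^ z" := (zexpg x z) (at level 30, right associativity)
  : group_scope.

Definition generalized_torsion (G : groupType) (g : G) : Prop :=
  g <> 1 /\
  exists (n : nat) (h : 'I_n -> G), (0 < n)%N /\ \prod_(i < n) g ^ h i = 1.

Inductive gterm (X : Type) : Type :=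
| GVar of X
| GOne
| GMul of gterm X & gterm X
| GInv of gterm X.

Arguments GOne {X}.

HB.instance Definition _ (X : Type) := gen_eqMixin (gterm X).
HB.instance Definition _ (X : Type) := gen_choiceMixin (gterm X).

(* Terms only form a lawless "base group"; this structure gives access to the
   library's notations x * y, x^-1, x ^+ n, [~ x, y] for writing relations. *)
HB.instance Definition _ (X : Type) := hasMul.Build (gterm X) (@GMul X).
HB.instance Definition _ (X : Type) := hasOne.Build (gterm X) GOne.
HB.instance Definition _ (X : Type) := hasInv.Build (gterm X) (@GInv X).

Section Presentation.
Variables (X : Type) (R : gterm X -> gterm X -> Prop).

Inductive pres_eq : gterm X -> gterm X -> Prop :=
| PresRel u v : R u v -> pres_eq u v
| PresRefl u : pres_eq u u
| PresSym u v : pres_eq u v -> pres_eq v u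
| PresTrans v u w : pres_eq u v -> pres_eq v w -> pres_eq u w
| PresMul u u' v v' :
    pres_eq u u' -> pres_eq v v' -> pres_eq (u * v) (u' * v')
| PresInv u u' : pres_eq u u' -> pres_eq u^-1 u'^-1
| PresA u v w : pres_eq (u * (v * w)) (u * v * w)
| Pres1l u : pres_eq (1 * u) u
| Pres1r u : pres_eq (u * 1) u
| PresVl u : pres_eq (u^-1 * u) 1
| PresVr u : pres_eq (u * u^-1) 1.

Definition pres_eqb : rel (gterm X) := fun u v => `[< pres_eq u v >].

Lemma pres_eqb_refl : reflexive pres_eqb.
Proof. by move=> u; apply/asboolP; apply: PresRefl. Qed.

Lemma pres_eqb_sym : symmetric pres_eqb.
Proof. by move=> u v; apply/asboolP/asboolP; apply: PresSym. Qed.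

Lemma pres_eqb_trans : transitive pres_eqb.
Proof.
by move=> v u w /asboolP uv /asboolP vw; apply/asboolP; apply: PresTrans uv vw.
Qed.

Canonical pres_equiv := EquivRel pres_eqb pres_eqb_refl pres_eqb_sym
  pres_eqb_trans.

Definition presented := {eq_quot pres_equiv}.

HB.instance Definition _ := Choice.on presented.
HB.instance Definition _ := Quotient.on presented.

Definition pres_of (u : gterm X) : presented := \pi_presented u.

Lemma pres_ofP u v : pres_of u = pres_of v <-> pres_eq u v.
Proof. by split=> [/eqmodP/asboolP | uv] //; apply/eqmodP/asboolP. Qed.

Lemma pres_reprK x : pres_of (repr x) = x.
Proof. exact: reprK. Qed.

Lemma pres_repr u : pres_eq (repr (pres_of u)) u.
Proof. by apply/pres_ofP; rewrite pres_reprK. Qed.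

Definition pres_mul (x y : presented) := pres_of (repr x * repr y).
Definition pres_inv (x : presented) := pres_of (repr x)^-1.

Lemma pres_of_mul u v : pres_mul (pres_of u) (pres_of v) = pres_of (u * v).
Proof. by apply/pres_ofP/PresMul; apply: pres_repr. Qed.

Lemma pres_of_inv u : pres_inv (pres_of u) = pres_of u^-1.
Proof. by apply/pres_ofP/PresInv/pres_repr. Qed.

Lemma pres_mulA : associative pres_mul.
Proof.
move=> x y z; rewrite -(pres_reprK x) -(pres_reprK y) -(pres_reprK z).
by rewrite !pres_of_mul; apply/pres_ofP/PresA.
Qed.

Lemma pres_mul1 : left_id (pres_of 1) pres_mul.
Proof.
by move=> x; rewrite -(pres_reprK x) pres_of_mul; apply/pres_ofP/Pres1l.
Qed.

Lemma pres_mulr1 : right_id (pres_of 1) pres_mul.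
Proof.
by move=> x; rewrite -(pres_reprK x) pres_of_mul; apply/pres_ofP/Pres1r.
Qed.

Lemma pres_mulV : left_inverse (pres_of 1) pres_inv pres_mul.
Proof.
move=> x; rewrite -(pres_reprK x) pres_of_inv pres_of_mul.
exact/pres_ofP/PresVl.
Qed.

Lemma pres_mulrV : right_inverse (pres_of 1) pres_inv pres_mul.
Proof.
move=> x; rewrite -(pres_reprK x) pres_of_inv pres_of_mul.
exact/pres_ofP/PresVr.
Qed.

HB.instance Definition _ := isGroup.Build presented
  pres_mulA pres_mul1 pres_mulr1 pres_mulV pres_mulrV.

Lemma pres_ofM u v : pres_of (u * v) = pres_of u * pres_of v.
Proof. exact/esym/pres_of_mul. Qed.

Lemma pres_ofV u : pres_of u^-1 = (pres_of u)^-1.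
Proof. exact/esym/pres_of_inv. Qed.

Lemma pres_of1 : pres_of 1 = 1.
Proof. by []. Qed.

End Presentation.

Fixpoint gterm_eval (X : Type) (G : groupType) (f : X -> G) (u : gterm X) : G :=
  match u with
  | GVar x => f x
  | GOne => 1
  | GMul u v => gterm_eval f u * gterm_eval f v
  | GInv u => (gterm_eval f u)^-1
  end.

Lemma presented_universal (X : Type) (R : gterm X -> gterm X -> Prop)
    (G : groupType) (f : X -> G) :
  (forall u v, R u v -> gterm_eval f u = gterm_eval f v) ->
  exists! phi : presented R -> G,
    {morph phi : x y / x * y} /\ forall x, phi (pres_of R (GVar x)) = f x.
Proof.
move=> fR.
have fE u v : pres_eq R u v -> gterm_eval f u = gterm_eval f v.
  elim=> {u v} /=; first exact: fR.
  - by [].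
  - by move=> u v _ ->.
  - by move=> v u w _ -> _ ->.
  - by move=> u u' v v' _ -> _ ->.
  - by move=> u u' _ ->.
  - by move=> u v w; apply: mulgA.
  - by move=> u; apply: mul1g.
  - by move=> u; apply: mulg1.
  - by move=> u; apply: mulVg.
  - by move=> u; apply: mulgV.
pose phi (x : presented R) := gterm_eval f (repr x).
have phiE u : phi (pres_of R u) = gterm_eval f u by apply/fE/pres_repr.
exists phi; split=> [|psi [psiM psiX]].
  split=> [x y|x]; last by rewrite phiE.
  exact: phiE.
apply/funext=> x; rewrite -(pres_reprK x) phiE.
have psi1 : psi 1 = 1 by apply: (mulgI (psi 1)); rewrite -psiM !mulg1.
elim: (repr x) => {x} [x||u IHu v IHv|u IHu] /=.
- by rewrite psiX.
- exact/esym.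
- by rewrite IHu IHv -psiM -pres_ofM.
- apply: (mulgI (gterm_eval f u)).
  by rewrite mulgV IHu -psiM (pres_ofV R u) mulgV psi1.
Qed.

Inductive dtk_gen : Type := DtkA | DtkB | DtkT.

Local Notation a := (GVar DtkA : gterm dtk_gen).
Local Notation b := (GVar DtkB : gterm dtk_gen).
Local Notation t := (GVar DtkT : gterm dtk_gen).

Inductive dtk_zero_surgery_rel (p q : int) :
    gterm dtk_gen -> gterm dtk_gen -> Prop :=
| DtkRelA : dtk_zero_surgery_rel p q (t * a ^^ p * t^-1) (b^-1 * a ^^ p)
| DtkRelB : dtk_zero_surgery_rel p q
    (t * b ^^ (- q)%R * a^-1 * t^-1) (b ^^ (- q)%R)
| DtkRelLongitude : dtk_zero_surgery_rel p q [~ b ^^ q, a ^^ p] 1.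

(* The fundamental group of the closed 3-manifold K_{p,q}(0) obtained by
   0-surgery on the double twist knot K_{p,q}, by its presentation
     < a, b, t | t a^p t^-1 = b^-1 a^p, t b^-q a^-1 t^-1 = b^-q,
                 [b^q, a^p] = 1 >,
   where t is a meridian and [b^q, a^p] the canonical longitude; K_{1,1} is the
   figure eight knot and K_{1,-1} the right-handed trefoil. *)
Definition pi1_dtk_zero_surgery (p q : int) : groupType :=
  presented (dtk_zero_surgery_rel p q).

(* Main.v *)
Require Import Defs.
From mathcomp Require Import all_boot all_order all_algebra.
From mathcomp Require Import perm.
From mathcomp Require Import zify.

Set Implicit Arguments.
Unset Strict Implicit.
Unset Printing Implicit Defensive.

Local Open Scope group_scope.

(** The proof splits on whether a and b commute in the group G of the
    0-surgery.

    If they do not, then [b, a] is a generalized torsion element: expanding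
    commutators of products writes [b^m, a^n], for positive m and n, as a
    product of conjugates of [b, a], and the longitude relation makes it
    trivial for m = |q| and n = |p| (conj_product_commg).

    If they do commute, then a itself is a generalized torsion element. Put
    N = |pq|. Up to powers the action of t on the subgroup generated by a and b
    is a linear map with characteristic polynomial the Alexander polynomial,
    which for pq < 0 is N x^2 - (2 N - 1) x + N. Its roots are exp(i theta) and
    exp(- i theta) with 2 - 2 cos theta = 1 / N, so t acts as a rotation. Some
    t^(2^k) rotates by an angle whose cosine is at most 0, and its
    characteristic polynomial is then proportional to one with nonnegative
    integer coefficients: evaluated on a power of a, it is a product of
    conjugates of a that equals 1. The lemma rotation_relation_square carries
    out the angle doubling with explicit exponents inside G, where t acts only
    on suitable powers of a and b; rotation_relation_conj_product iterates it.

    It remains to see that a is nontrivial. Modulo 4 N - 1 (the value of the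
    Alexander polynomial at -1, the determinant of the knot) the action
    x -> - x satisfies the polynomial, so G maps to a dihedral group with a
    going to a nontrivial rotation (dtk_a_neq1). *)

(** * Products of conjugates *)

(** Generalized torsion means that 1 is such a product; other values of x allow
    the reasoning to pass through intermediate elements, by transitivity. *)
Definition conj_product (G : groupType) (g x : G) : Prop :=
  exists2 s : seq G, s != [::] & \prod_(h <- s) g ^ h = x.

Section ConjProduct.
Variable G : groupType.
Implicit Types g x y z h v t : G.

Lemma conj_product_conj g h : conj_product g (g ^ h).
Proof. by exists [:: h]; rewrite // big_seq1. Qed.

Lemma conj_product_refl g : conj_product g g.
Proof. by rewrite -{2}[g]conjg1; apply: conj_product_conj. Qed.

Lemma conj_productM g x y :
  conj_product g x -> conj_product g y -> conj_product g (x * y).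
Proof.
move=> [s s0 <-] [r _ <-]; exists (s ++ r); last by rewrite big_cat.
by case: s s0.
Qed.

Lemma conj_productJ g x h : conj_product g x -> conj_product g (x ^ h).
Proof.
move=> [s s0 <-]; exists [seq k * h | k <- s]; first by case: s s0.
rewrite big_map conjg_prod; apply: eq_bigr => k _; exact: conjgM.
Qed.

Lemma conj_productX g x n :
  (0 < n)%N -> conj_product g x -> conj_product g (x ^+ n).
Proof.
case: n => // n _ gx; elim: n => [|n IHn]; first by rewrite expg1.
by rewrite expgS; apply: conj_productM.
Qed.

Lemma conj_product_trans g x y :
  conj_product g x -> conj_product x y -> conj_product g y.
Proof.
move=> gx [s s0 <-]; elim: s s0 => // h s IHs _.
case: s IHs => [_|k s IHs]; first by rewrite big_seq1; apply: conj_productJ.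
by rewrite big_cons; apply: conj_productM; [apply: conj_productJ | apply: IHs].
Qed.

Lemma generalized_torsion_conj_product g :
  g <> 1 -> conj_product g 1 -> generalized_torsion g.
Proof.
move=> g1 [s s0 sg]; split=> //; exists (size s), (tnth (in_tuple s)).
by split; [case: s s0 {sg} | rewrite -[RHS]sg (big_tnth _ _ s)].
Qed.

(** * Commutators with commuting powers *)

Lemma commgMl x y z : [~ x * y, z] = [~ x, z] ^ y * [~ y, z].
Proof. by rewrite !commgEl !conjMg conjVg !conjgE; rewrite !gnorm. Qed.

Lemma commgMr x y z : [~ x, y * z] = [~ x, z] * [~ x, y] ^ z.
Proof. by rewrite !commgEl !conjMg conjVg !conjgE; rewrite !gnorm. Qed.

(** Iterating [xy, z] = [x, z]^y [y, z] expresses [x^m, y] through [x, y], and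
    the mirror identity expresses [x^m, y^n] through [x^m, y]. *)
Lemma conj_product_commg x y m n : (0 < m)%N -> (0 < n)%N ->
  conj_product [~ x, y] [~ x ^+ m, y ^+ n].
Proof.
move=> m0 n0.
have Xl : conj_product [~ x, y] [~ x ^+ m, y].
  case: m m0 => // m _; elim: m => [|m IHm].
    by rewrite expg1; apply: conj_product_refl.
  rewrite expgS commgMl; apply: conj_productM => //.
  exact: conj_product_conj.
apply: conj_product_trans Xl _.
case: n n0 => // n _; elim: n => [|n IHn].
  by rewrite expg1; apply: conj_product_refl.
by rewrite expgS commgMr; apply: conj_productM => //; apply: conj_product_conj.
Qed.

Lemma commute_powers_generalized_torsion x y m n : (0 < m)%N -> (0 < n)%N ->
  commute (x ^+ m) (y ^+ n) -> [~ x, y] <> 1 -> generalized_torsion [~ x, y].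
Proof.
move=> m0 n0 /commgP/eqP xy1 ne1; apply: generalized_torsion_conj_product => //.
by rewrite -xy1; apply: conj_product_commg.
Qed.

(** * Rotation relations *)

(** Written additively, with x the action of conjugation by t, the relation says
    that N (x^-1 + x) = 2 N - e on v, so that x is a rotation by an angle theta
    with 2 - 2 cos theta = e / N. Squaring t doubles the angle, and
    2 - 2 cos (2 theta) = (e / N) (4 - e / N). Replacing v by v^N is what makes
    its conjugates under t^2 and t^-2 words in v and in its conjugates under t
    and t^-1, so that commutation with v is inherited. *)
Lemma rotation_relation_square v t N e : (e <= N.*2)%N ->
  commute v (v ^ t^-1) ->
  (v ^ t^-1) ^+ N * (v ^ t) ^+ N * v ^+ e = v ^+ N.*2 ->
  let v' := v ^+ N in let t' := t ^+ 2 in let N' := (N * N)%N in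
  commute v' (v' ^ t'^-1) /\
  (v' ^ t'^-1) ^+ N' * (v' ^ t') ^+ N' * v' ^+ (e * (4 * N - e)) = v' ^+ N'.*2.
Proof.
move=> eN vX rel /=.
set X := v ^ t^-1 in vX rel; set Y := v ^ t in rel.
(* N (x^-1 + x) = c on v. *)
pose c := (N.*2 - e)%N.
have XY : X ^+ N * Y ^+ N = v ^+ c.
  by apply: (mulIg (v ^+ e)); rewrite rel -expgnDr subnK.
have Xt : X ^ t = v by rewrite -conjgM mulVg conjg1.
have Yt : Y ^ t^-1 = v by rewrite -conjgM mulgV conjg1.
have vY : commute v Y by rewrite /commute /Y -{1 4}Xt -!conjMg vX.
pose U := v ^+ N ^ (t ^+ 2)^-1; pose W := v ^+ N ^ (t ^+ 2).
(* Conjugating X^N Y^N = v^c by t^-1 and by t brings in t^2 and t^-2. *)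
have UE : U * v ^+ N = X ^+ c.
  have := congr1 (conjg^~ t^-1) XY.
  by rewrite /= conjMg !conjXg Yt /U expg2 invgM conjgM => <-; rewrite !conjXg.
have WE : v ^+ N * W = Y ^+ c.
  have := congr1 (conjg^~ t) XY.
  by rewrite /= conjMg !conjXg Xt /W expg2 conjgM => <-; rewrite !conjXg.
have {}UE : U = X ^+ c * v ^- N by rewrite -UE mulgK.
have {}WE : W = v ^- N * Y ^+ c by rewrite -WE mulKg.
have vXc : commute v (X ^+ c) by apply: commuteX.
have vYc : commute v (Y ^+ c) by apply: commuteX.
have vU : commute v U.
  by rewrite UE; apply: commuteM => //; apply/commuteV/commuteX.
split; first exact/commute_sym/commuteX/commute_sym.
set P := X ^+ N in XY; set Q := Y ^+ N in XY.
(* X and Y need not commute, but these powers do, because their product is a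
   power of v. *)
have PQ : commute P Q.
  have -> : P = v ^+ c * Q^-1 by rewrite -XY mulgK.
  apply/commute_sym/commuteM; last exact/commuteV.
  by apply/commuteX/commute_sym/commuteX.
have vP : commute v P by apply: commuteX.
pose M := (N * N)%N.
have UM : U ^+ M = P ^+ (N * c) * v ^- (N * M).
  rewrite UE expgMn; last by apply/commuteV/commuteX/commute_sym.
  by rewrite expVgn -!expgnA; congr (_ ^+ _ * _); rewrite /M; lia.
have WM : W ^+ M = v ^- (N * M) * Q ^+ (N * c).
  rewrite WE expgMn; last first.
    by apply/commute_sym/commuteV/commuteX/commute_sym.
  by rewrite expVgn -!expgnA; congr (_ * _ ^+ _); rewrite /M; lia.
have vN'P : commute (v ^- (N * M)) (P ^+ (N * c)).
  exact/commute_sym/commuteV/commute_sym/commuteX2.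
have UWM :
  v ^+ (N * M) * (v ^+ (N * M) * (U ^+ M * W ^+ M)) = v ^+ (c * (N * c)).
  rewrite UM WM -vN'P -mulgA mulVKg [P ^+ _ * _]mulgA -vN'P -mulgA mulVKg.
  by rewrite -expgMn // XY -expgnA.
apply: (mulgI (v ^+ (N * M))); apply: (mulgI (v ^+ (N * M))).
rewrite 2![v ^+ (N * M) * (_ * _ * _)]mulgA UWM -!expgnA -!expgnDr.
(* With e + c = 2 N the exponents agree because c ^ 2 + e (2 c + e) is
   (c + e) ^ 2. *)
congr (_ ^+ _).
have eE : (4 * N - e = 2 * c + e)%N by rewrite /c; lia.
have NE : (2 * N = c + e)%N by rewrite /c; lia.
rewrite eE /M -!mul2n; nia.
Qed.

(** When the rotation angle is at least a right angle the coefficient 2 N - e is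
    nonpositive, so cancelling v^(2 N) leaves a relation with nonnegative
    exponents. *)
Lemma obtuse_rotation_relation v t N e : (0 < N)%N -> (N.*2 <= e)%N ->
  (v ^ t^-1) ^+ N * (v ^ t) ^+ N * v ^+ e = v ^+ N.*2 -> conj_product v 1.
Proof.
move=> N0 Ne rel.
have <- : (v ^ t^-1) ^+ N * (v ^ t) ^+ N * v ^+ (e - N.*2) = 1.
  by apply: (mulIg (v ^+ N.*2)); rewrite -mulgA -expgnDr subnK // rel mul1g.
have vXY : conj_product v ((v ^ t^-1) ^+ N * (v ^ t) ^+ N).
  by apply: conj_productM; apply: conj_productX => //; apply: conj_product_conj.
case: (e - N.*2)%N => [|d]; first by rewrite mulg1.
by apply: conj_productM => //; apply/conj_productX/conj_product_refl.
Qed.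

(** Doubling an acute angle multiplies e / N by 4 - e / N, hence at least by 2;
    k is the number of doublings after which e / N is sure to reach 2. *)
Lemma rotation_relation_conj_product k v t N e :
  (0 < N)%N -> (N.*2 <= 2 ^ k * e)%N ->
  commute v (v ^ t^-1) ->
  (v ^ t^-1) ^+ N * (v ^ t) ^+ N * v ^+ e = v ^+ N.*2 -> conj_product v 1.
Proof.
elim: k v t N e => [|k IHk] v t N e N0 Nke vX rel; have [Ne|eN] := leqP N.*2 e.
- exact: obtuse_rotation_relation Ne rel.
- by lia.
- exact: obtuse_rotation_relation Ne rel.
have [] := rotation_relation_square (ltnW eN) vX rel.
set v' := v ^+ N => v'X rel'.
have vv' : conj_product v v'.
  by apply: conj_productX => //; apply: conj_product_refl.
apply: conj_product_trans vv' _.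
apply: IHk v'X rel'; first by rewrite muln_gt0 N0.
have: (N * N.*2 <= N * (2 ^ k.+1 * e))%N by rewrite leq_mul2l Nke orbT.
rewrite expnS -!mul2n; nia.
Qed.

(** * The commuting case *)

(** The relation for v = a^p with N = p r and e = 1 comes from
    (v^(t^-1))^r = b^-r a^N and (v^t)^r = b^r a^-1 a^N, whose product is
    a^(2 N - 1). *)
Lemma commute_generators_conj_product a b t p r : (0 < p)%N -> (0 < r)%N ->
  commute a b -> (a ^+ p) ^ t^-1 = b^-1 * a ^+ p ->
  (b ^+ r) ^ t = b ^+ r * a^-1 -> conj_product a 1.
Proof.
move=> p0 r0 ab At Bt; pose v := a ^+ p; pose N := (p * r)%N.
have bv : commute b v by apply/commuteX/commute_sym.
have bV : commute b^-1 v by exact/commute_sym/commuteV/commute_sym.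
apply: (conj_product_trans (conj_productX p0 (conj_product_refl a))).
have vt : v ^ t = b ^ t * v.
  by rewrite -[v in RHS](conjgKV t) At conjMg conjVg mulVKg.
have btv : commute (b ^ t) v.
  have -> : v = (b ^ t)^-1 * v ^ t by rewrite vt mulKg.
  apply: commuteM; first exact: commuteV.
  by rewrite /commute -!conjMg bv.
have Xr : (v ^ t^-1) ^+ r = b ^- r * a ^+ N.
  by rewrite At expgMn // expVgn -expgnA.
have Yr : (v ^ t) ^+ r = b ^+ r * a^-1 * a ^+ N.
  by rewrite vt expgMn // -conjXg Bt -expgnA.
apply: (@rotation_relation_conj_product N.*2 v t N 1).
- by rewrite muln_gt0 p0.
- by rewrite muln1 ltnW // ltn_expl.
- by rewrite At; apply: commuteM => //; exact: commute_sym.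
have ba := commute_sym ab.
have aYr : commute a (b ^+ r * a^-1 * a ^+ N).
  by do !apply: commuteM; [apply: commuteX|apply: commuteV|apply: commuteX].
have bYr : commute b (b ^+ r * a^-1 * a ^+ N).
  by do !apply: commuteM; [apply: commuteX|apply: commuteV|apply: commuteX].
have aXY : commute a ((v ^ t^-1) ^+ r * (v ^ t) ^+ r).
  by rewrite Xr Yr; apply: commuteM => //; apply: commuteM;
    [apply/commuteV/commuteX | apply: commuteX].
have XY : (v ^ t^-1) ^+ r * (v ^ t) ^+ r * a = a ^+ N.*2.
  have aNb : commute (a ^+ N) (b ^+ r) by apply: commuteX2.
  rewrite Xr Yr -!mulgA -expgSr expgS mulKg.
  by rewrite [a ^+ N * (b ^+ r * _)]mulgA aNb -mulgA mulKg -expgnDr addnn.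
have cXY : commute ((v ^ t^-1) ^+ r) ((v ^ t) ^+ r).
  rewrite Xr Yr; apply/commute_sym/commuteM.
    exact/commuteV/commuteX/commute_sym.
  exact/commuteX/commute_sym.
have NE : N = (r * p)%N by rewrite /N mulnC.
rewrite {1 2}NE 2!expgnA -expgMn // expg1 -expgMn; last exact: commute_sym.
by rewrite XY -!expgnA; congr (_ ^+ _); lia.
Qed.

End ConjProduct.

(** * Integer powers *)

Lemma commute_absz (G : groupType) (x y : G) z :
  commute (x ^^ z) y -> commute (x ^+ `|z|) y.
Proof.
case: z => // n /commute_sym/commuteV; rewrite /= invgK; exact: commute_sym.
Qed.

Section Terms.
Variable X : Type.

Lemma pres_of_zexpg (R : gterm X -> gterm X -> Prop) u z :
  pres_of R (u ^^ z) = pres_of R u ^^ z.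
Proof.
have powE n : pres_of R (u ^+ n) = pres_of R u ^+ n.
  case: n => // n; elim: n => // n IHn.
  by rewrite expgSS pres_ofM IHn -expgS.
by case: z => n /=; rewrite ?pres_ofV powE.
Qed.

Lemma gterm_eval_zexpg (G : groupType) (f : X -> G) (u : gterm X) z :
  gterm_eval f (u ^^ z) = gterm_eval f u ^^ z.
Proof.
have powE n : gterm_eval f (u ^+ n) = gterm_eval f u ^+ n.
  by case: n => // n; elim: n => // n IHn; rewrite expgSS expgS -IHn.
by case: z => n /=; rewrite powE.
Qed.

End Terms.

(** * The dihedral quotient *)

Section Dihedral.
Variable V : finZmodType.
Import GRing.Theory.

Definition translation (k : V) : {perm V} := perm (addIr k).
Definition reflection : {perm V} := perm (@oppr_inj V).

Lemma translationD k l : translation (k + l)%R = translation k * translation l.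
Proof. by apply/permP => x; rewrite permM !permE addrA. Qed.

Lemma translation0 : translation 0%R = 1.
Proof. by apply/permP => x; rewrite !permE addr0. Qed.

Lemma translationN k : translation (- k)%R = (translation k)^-1.
Proof. by apply/esym/mulg1_eq; rewrite -translationD subrr translation0. Qed.

Lemma translation_zexpg k z : translation k ^^ z = translation (k *~ z)%R.
Proof.
have E n : translation k ^+ n = translation (k *+ n)%R.
  elim: n => [|n IHn]; first by rewrite translation0.
  by rewrite expgS IHn -translationD -mulrS.
by case: z => n /=; rewrite E // -translationN.
Qed.

Lemma translation_reflection k :
  reflection * translation k * reflection^-1 = translation (- k)%R.
Proof.
apply: (mulIg reflection); rewrite mulgVK.
by apply/permP => x; rewrite !permM !permE opprD opprK.
Qed.

Lemma translation_eq1 k : translation k = 1 -> k = 0%R.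
Proof. by move/permP/(_ 0%R); rewrite !permE add0r. Qed.

End Dihedral.

(** The first relation forces the rotation b = 2 p as soon as a = 1 and t is the
    reflection; the second one then asks for 4 p q = -1. *)
Definition dihedral_gen n (p : int) (x : dtk_gen) : {perm 'Z_n} :=
  match x with
  | DtkA => translation (1%R : 'Z_n)
  | DtkB => translation (p%:~R *+ 2)%R
  | DtkT => reflection _
  end.

Import GRing.Theory Num.Theory.

Lemma dihedral_gen_rel n (p q : int) : (1 < n)%N -> (4 * p * q + n%:Z = -1)%R ->
  forall u v, dtk_zero_surgery_rel p q u v ->
  gterm_eval (dihedral_gen n p) u = gterm_eval (dihedral_gen n p) v.
Proof.
move=> n1 pqn _ _ [].
- rewrite /= !gterm_eval_zexpg /= !translation_zexpg translation_reflection.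
  rewrite -translationN -translationD; congr translation.
  by rewrite mulr2n opprD -addrA addNr addr0.
- rewrite /= !gterm_eval_zexpg /= !translation_zexpg.
  rewrite -translationN -(mulgA (reflection _)) -translationD.
  rewrite translation_reflection; congr translation.
  have pq1 : (4 * p%:~R * q%:~R = -1 :> 'Z_n)%R.
    have := congr1 (fun z : int => z%:~R : 'Z_n)%R pqn.
    rewrite rmorphD rmorphN /= !rmorphM /= -[(n%:~R)%R]/(n%:R)%R.
    by rewrite pchar_Zp // addr0.
  rewrite -mulrzr mulrNz mulrN opprB; apply/eqP; rewrite subr_eq -opprD.
  by rewrite -mulrDl -mulr_natl -mulrDl -natrD pq1 opprK.
- rewrite /= !gterm_eval_zexpg /= !translation_zexpg.
  by rewrite -!translationN -!translationD addrA -opprD addNr translation0.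
Qed.

Lemma dtk_a_neq1 (p q : int) : (p * q < 0)%R ->
  pres_of (dtk_zero_surgery_rel p q) (GVar DtkA) <> 1.
Proof.
move=> pq0 a1; pose n := (4 * `|(p * q)%R|).-1%N.
have n1 : (1 < n)%N by rewrite /n; lia.
have pqn : (4 * p * q + n%:Z = -1)%R by rewrite /n -mulrA; lia.
have [phi [[phiM phiX] _]] := presented_universal (dihedral_gen_rel n1 pqn).
have phi1 : phi 1 = 1 by apply: (mulgI (phi 1)); rewrite -phiM !mulg1.
have := phiX DtkA; rewrite a1 phi1 => /esym /translation_eq1 /eqP.
by rewrite oner_eq0.
Qed.

(** * Generalized torsion *)

(** For p < 0 < q, inverting the first relation and replacing b by its inverse
    makes both exponents positive. *)
Lemma commute_dtk_conj_product (G : groupType) (a b t : G) (p q : int) :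
  (p * q < 0)%R -> commute b a -> (a ^^ p) ^ t^-1 = b^-1 * a ^^ p ->
  (b ^^ (- q)%R) ^ t = b ^^ (- q)%R * a^-1 -> conj_product a 1.
Proof.
move=> pq0 ba; case: p q pq0 => [m|m] [n|n] pq0; try lia.
- rewrite NegzE opprK => /= relA relB.
  by apply: (@commute_generators_conj_product _ a b t m n.+1) => //; lia.
- case: n pq0 => [|n _ /=]; first by lia.
  move=> relA relB.
  apply: (@commute_generators_conj_product _ a b^-1 t m.+1 n.+1) => //.
  + exact/commuteV/commute_sym.
  + rewrite conjVg in relA; rewrite -[LHS]invgK relA invgM !invgK.
    exact/commute_sym/commuteX.
  + by rewrite expVgn relB.
Qed.

Theorem theorem1p2 (p q : int) (hp : p <> 0%R) (hq : q <> 0%R)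
  (hpq : (p * q < 0)%R) :
  exists g : pi1_dtk_zero_surgery p q, generalized_torsion g.
Proof.
pose G := pi1_dtk_zero_surgery p q.
pose pr : gterm dtk_gen -> G := pres_of (dtk_zero_surgery_rel p q).
pose a := pr (GVar DtkA); pose b := pr (GVar DtkB); pose t := pr (GVar DtkT).
have relA : t * a ^^ p * t^-1 = b^-1 * a ^^ p.
  have /pres_ofP := PresRel (DtkRelA p q).
  by rewrite !pres_ofM !pres_ofV !pres_of_zexpg.
have relB : t * b ^^ (- q)%R * a^-1 * t^-1 = b ^^ (- q)%R.
  have /pres_ofP := PresRel (DtkRelB p q).
  by rewrite !pres_ofM !pres_ofV !pres_of_zexpg.
have relL : commute (b ^^ q) (a ^^ p).
  apply/commgP/eqP; have /pres_ofP := PresRel (DtkRelLongitude p q).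
  by rewrite /commg /conjg !pres_ofM !pres_ofV !pres_of_zexpg.
have a1 : a <> 1 by apply: dtk_a_neq1.
have [ab|] := eqVneq [~ b, a] 1; last first.
  move=> /eqP ab; exists [~ b, a].
  apply: (@commute_powers_generalized_torsion _ b a `|q| `|p|) => //; try lia.
  exact/commute_absz/commute_sym/commute_absz/commute_sym.
exists a; apply: generalized_torsion_conj_product => //.
move/eqP/commgP: ab => ba.
have {}relA : (a ^^ p) ^ t^-1 = b^-1 * a ^^ p.
  by rewrite -relA conjgE invgK mulgA.
have {}relB : (b ^^ (- q)%R) ^ t = b ^^ (- q)%R * a^-1.
  by rewrite -{1}relB conjgE mulgVK -!mulgA mulKg.
exact: (@commute_dtk_conj_product G a b t p q hpq).
Qed.
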